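(* Let $\psi\in\mathrm{Conv}_{\mathrm c}(\mathbb{R}^n)$ and let $Y\subseteq\mathbb{R}^n$ be nonempty. The function $q_{\psi,Y}$ is an element of $\mathrm{Conv}_{\mathrm c}(\mathbb{R}^n)$ if and only if there exists $Y_o\subseteq Y$ such that $$Y_o\subseteq\mathrm{dom}(\mathcal{L}\psi)\quad\text{and}\quad\mathrm{pos}(Y_o)=\mathbb{R}^n.$$
   Context: $\mathrm{Conv}_{\mathrm c}(\mathbb{R}^n)$ is the set of convex functions $\psi\colon\mathbb{R}^n\to(-\infty,\infty]$ that are proper ($\psi\not\equiv\infty$), lower semicontinuous, and coercive ($\lim_{|x|\to\infty}\psi(x)=\infty$). Here $n\geq 1$. Legendre--Fenchel transform: $\mathcal{L}\psi(x)=\sup_{y\in\mathbb{R}^n}(\langle x,y\rangle-\psi(y))$; $\mathrm{dom}(\varphi)=\{x:\varphi(x)<\infty\}$. $\mathrm{pos}$ denotes the positive hull (all finite nonnegative linear combinations). Generalized outer linearization: for $y\in\mathbb{R}^n$, $\ell_{\psi,y}(x)=\langle x,y\rangle+c$ with $c\in[-\infty,\infty)$ maximal such that $\ell_{\psi,y}\le\psi$ pointwise ($c=-\infty$, i.e. $\ell_{\psi,y}\equiv-\infty$, if no real $c$ works). For nonempty $Y\subseteq\mathbb{R}^n$, $q_{\psi,Y}(x)=\sup_{y\in Y}\ell_{\psi,y}(x)\in[-\infty,\infty]$. *)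

(* Defs.v *)
From HB Require Import structures.
From mathcomp Require Import all_boot all_order all_algebra.
From mathcomp Require Import all_classical all_reals all_analysis.

Set Implicit Arguments.
Unset Strict Implicit.
Unset Printing Implicit Defensive.

Import Order.TTheory GRing.Theory Num.Theory.
Import numFieldNormedType.Exports.

Local Open Scope classical_set_scope.
Local Open Scope ring_scope.

Section Definitions.
Context {R : realType} {n : nat}.
Implicit Types (x y z : 'rV[R]_n) (f psi : 'rV[R]_n -> \bar R)
  (A Y : set 'rV[R]_n).

Definition dot x y : R := \sum_(i < n) x 0 i * y 0 i.

(* Euclidean norm; the library norm `|x| on row vectors is the sup norm. *)
Definition enorm x : R := Num.sqrt (dot x x).

(* For functions that avoid -oo; the library convention 0 * +oo = 0 makes the
   cases t = 0 and t = 1 trivial. *)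
Definition econvex f : Prop :=
  forall x y (t : R), 0 <= t <= 1 ->
    (f (t *: x + (1 - t) *: y)%R <= t%:E * f x + (1 - t)%:E * f y)%E.

Definition proper f : Prop := exists x, (f x < +oo)%E.

Definition coercive f : Prop :=
  forall M : R, exists r : R, forall x, r < enorm x -> (M%:E < f x)%E.

Definition Conv_c : set ('rV[R]_n -> \bar R) :=
  [set f | (forall x, -oo < f x)%E /\
           [/\ econvex f, proper f, lower_semicontinuous f & coercive f]].

Definition legendre psi x : \bar R :=
  ereal_sup [set ((dot x y)%:E - psi y)%E | y in setT].

Definition dom f : set 'rV[R]_n := [set x | (f x < +oo)%E].

Definition pos A : set 'rV[R]_n :=
  [set x | exists (m : nat) (a : 'I_m -> 'rV[R]_n) (c : 'I_m -> R),
     [/\ forall i, A (a i), forall i, 0 <= c i & x = \sum_(i < m) c i *: a i]].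

Definition affine_minorant psi y : set (\bar R) :=
  [set c | (c < +oo)%E /\ forall x, ((dot x y)%:E + c <= psi x)%E].

(* The supremum is attained when psi is proper: see intercept_max. *)
Definition intercept psi y : \bar R := ereal_sup (affine_minorant psi y).

Definition outer_lin psi y x : \bar R := ((dot x y)%:E + intercept psi y)%E.

Definition outer_lin_sup psi Y x : \bar R :=
  ereal_sup [set outer_lin psi y x | y in Y].

Lemma intercept_max psi y : proper psi ->
  affine_minorant psi y (intercept psi y) /\
  (forall c, affine_minorant psi y c -> (c <= intercept psi y)%E).
Proof.
move=> [x0 x0fin].
have le_int x : (intercept psi y <= psi x - (dot x y)%:E)%E.
  apply: ge_ereal_sup => c [_ /(_ x)].
  by rewrite leeBrDr// addeC.
split; last by move=> c; exact: ereal_sup_ubound.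
split=> [|x]; last by rewrite addeC -leeBrDr.
apply: le_lt_trans (le_int x0) _.
by case: (psi x0) x0fin => [r||]//= _; rewrite ?ltry.
Qed.

End Definitions.

(* Main.v *)
Require Import Defs.
From HB Require Import structures.
From mathcomp Require Import all_boot all_order all_algebra.
From mathcomp Require Import all_classical all_reals all_analysis.
From mathcomp Require Import ring lra.

(** The intercept of the affine minorant of [psi] with slope [y] is minus the
    Legendre transform of [psi] at [y] ([interceptE]).  So the slopes of [Y]
    outside the domain of the transform contribute only the constant -oo, and
    the supremum [q] is governed by the slopes inside.

    If nonnegative combinations of such slopes fill the space, then every
    coordinate function and its opposite are nonnegative combinations of slopes
    [y] with [<x, y> <= q x + const].  Hence the sublevel sets of [q] are
    bounded ([coercive_outer_lin_sup]).  The other properties of [q] hold for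
    any supremum of affine minorants of [psi] of which one is finite.

    Conversely, let [q] be coercive and take as [Yo] all slopes of [Y] in the
    domain.  If some nonzero [u] had [<u, y> <= 0] for all [y] in [Yo], then [q]
    would not increase along any ray of direction [u] ([outer_lin_sup_ray]),
    against coercivity ([coercive_unbounded_ray]).  So every nonzero [u] makes a
    positive product with some slope in [Yo], and it remains to see that [Yo]
    then spans positively ([pos_setT_of_no_polar]).  This is a separation
    theorem for a cone which need not be closed.  By compactness of the unit
    sphere finitely many [a_i] in [Yo] suffice to meet every [u].  Writing
    [t^+] for the positive part of [t], the function
    [F x = \sum_i (<x, a_i>^+)^2 - 2 <x, v>] then has a minimiser for each
    [v], and the vanishing of its gradient there reads
    [v = \sum_i <x, a_i>^+ a_i], a nonnegative combination of the [a_i]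
    ([finite_positive_combination]). *)

Set Implicit Arguments.
Unset Strict Implicit.
Unset Printing Implicit Defensive.

Import Order.TTheory GRing.Theory Num.Theory.
Import numFieldNormedType.Exports.

Local Open Scope classical_set_scope.
Local Open Scope ring_scope.

(** * The scalar product and the two norms *)

Section DotProduct.
Context {R : realType} {n : nat}.
Implicit Types x y z : 'rV[R]_n.

Lemma dotC x y : dot x y = dot y x.
Proof. by apply: eq_bigr => i _; rewrite mulrC. Qed.

Lemma dotDl x y z : dot (x + y) z = dot x z + dot y z.
Proof.
by rewrite /dot -big_split /=; apply: eq_bigr => i _; rewrite mxE mulrDl.
Qed.

Lemma dotZl a x z : dot (a *: x) z = a * dot x z.
Proof.
by rewrite /dot mulr_sumr; apply: eq_bigr => i _; rewrite mxE mulrA.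
Qed.

Lemma dot_sumZr m (c : 'I_m -> R) (a : 'I_m -> 'rV[R]_n) x :
  dot x (\sum_(i < m) c i *: a i) = \sum_(i < m) c i * dot x (a i).
Proof.
rewrite /dot; under [RHS]eq_bigr do rewrite mulr_sumr.
rewrite exchange_big /=; apply: eq_bigr => j _.
by rewrite summxE mulr_sumr; apply: eq_bigr => i _; rewrite mxE mulrCA.
Qed.

Lemma dot_ge0 x : 0 <= dot x x.
Proof. by apply: sumr_ge0 => i _; rewrite -expr2 sqr_ge0. Qed.

Lemma dot_eq0 x : dot x x = 0 -> x = 0.
Proof.
move=> /psumr_eq0P x0; apply/rowP => i; rewrite mxE.
apply/eqP; rewrite -sqrf_eq0 expr2; apply/eqP/x0 => // j _.
by rewrite -expr2 sqr_ge0.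
Qed.

Lemma dot_delta x i : dot x (delta_mx 0 i) = x 0 i.
Proof.
rewrite /dot (bigD1 i)//= big1 => [|j ji].
  by rewrite mxE !eqxx mulr1 addr0.
by rewrite mxE (negbTE ji) andbF mulr0.
Qed.

Lemma coord_le_norm x i : `|x 0 i| <= `|x|.
Proof.
by rewrite [leRHS]/Num.norm/= mx_normrE; apply/bigmax_geP; right; exists (0, i).
Qed.

Lemma dot_le_norm x v : dot x v <= `|x| * \sum_i `|v 0 i|.
Proof.
rewrite mulr_sumr; apply: ler_sum => i _.
by rewrite (le_trans (ler_norm _))// normrM ler_wpM2r// coord_le_norm.
Qed.

Lemma coord_le_enorm x i : `|x 0 i| <= enorm x.
Proof.
rewrite -sqrtr_sqr ler_sqrt ?dot_ge0// /dot (bigD1 i)//= -expr2 lerDl.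
by apply: sumr_ge0 => j _; rewrite -expr2 sqr_ge0.
Qed.

Lemma enorm_le_sum x : enorm x <= \sum_i `|x 0 i|.
Proof.
have S0 : 0 <= \sum_i `|x 0 i| by apply: sumr_ge0.
rewrite /enorm -(ger0_norm S0) -sqrtr_sqr ler_sqrt ?sqr_ge0//.
rewrite expr2 mulr_suml; apply: ler_sum => i _.
rewrite (le_trans (ler_norm _))// normrM ler_wpM2l//.
by rewrite (bigD1 i)//= lerDl sumr_ge0.
Qed.

End DotProduct.

(** * Continuity and compactness *)

Lemma continuous_sum (R : realType) (T : topologicalType) (I : Type)
    (s : seq I) (f : I -> T -> R) :
  (forall i, continuous (f i)) -> continuous (fun x => \sum_(i <- s) f i x).
Proof.
move=> cf; elim: s => [|i s IH].
  by under eq_fun do rewrite big_nil; move=> x; exact: cvg_cst.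
under eq_fun do rewrite big_cons.
by move=> x; apply: cvgD; [exact: cf|exact: IH].
Qed.

Lemma dot_continuous (R : realType) n (y : 'rV[R]_n) :
  continuous (fun x => dot x y).
Proof.
apply: continuous_sum => i x.
apply: (@cvgM _ _ (nbhs x)); last exact: cvg_cst.
exact: (@coord_continuous R 1 n 0 i x).
Qed.

Lemma unit_sphere_compact (R : realType) n :
  compact [set x : 'rV[R]_n | `|x| = 1].
Proof.
apply: bounded_closed_compact.
  by exists 1; split => // M M1 x /= ->; exact: ltW.
apply: (@preimage_closed _ _ (fun x : 'rV[R]_n => `|x|) [set t | t = 1]).
  by move=> x _; exact: norm_continuous.
exact: closed_eq.
Qed.

Lemma closed_norm_ball_compact (R : realType) n (r : R) :
  compact [set x : 'rV[R]_n | `|x| <= r].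
Proof.
apply: bounded_closed_compact.
  exists r; split => [|M M1 x /= /le_trans]; last by apply; exact: ltW.
  exact: num_real.
apply: (@preimage_closed _ _ (fun x : 'rV[R]_n => `|x|) [set t | t <= r]).
  by move=> x _; exact: norm_continuous.
exact: closed_le.
Qed.

(** * Positively spanning families *)

Section PositiveSpanning.
Context {R : realType}.

Definition posp (t : R) := Num.max t 0.

Lemma posp_continuous : continuous posp.
Proof.
move=> x; apply: (@continuous_max R _ id (cst 0)); first exact: cvg_id.
exact: cvg_cst.
Qed.

Lemma posp_ge0 t : 0 <= posp t.
Proof. by rewrite /posp le_max lexx orbT. Qed.

(** The square of the positive part lies below the parabola that touches it at
    [a]; this one-sided expansion replaces a derivative when the sum of such
    squares is minimised. *)
Lemma pospD_sqr_le a b : posp (a + b) ^+ 2 <= (posp a + b) ^+ 2.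
Proof.
rewrite /posp; case: (leP (a + b) 0) => ab0; first by rewrite expr0n/= sqr_ge0.
rewrite lerXn2r ?nnegrE ?lerD2r ?le_max ?lexx//; first exact: ltW.
by apply: le_trans (ltW ab0) _; rewrite lerD2r le_max lexx.
Qed.

Lemma pospM a t : 0 <= a -> posp (a * t) = a * posp t.
Proof. by move=> a0; rewrite /posp maxr_pMr// mulr0. Qed.

Lemma sqr_posp_dot_continuous n (y : 'rV[R]_n) :
  continuous (fun x => posp (dot x y) ^+ 2).
Proof.
move=> x.
apply: (@continuous_comp _ _ _ (fun x => dot x y) (fun t => posp t ^+ 2)).
  exact: dot_continuous.
by apply: (@cvgM _ _ (nbhs (dot x y))); exact: posp_continuous.
Qed.

(** The right-hand side is continuous, positive on the compact unit sphere and
    homogeneous of degree two, so its minimum on the sphere serves as [d]. *)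
Lemma sum_posp_ge_norm n m (a : 'I_m -> 'rV[R]_n) :
  (forall u, u != 0 -> exists i, 0 < dot u (a i)) ->
  exists2 d : R, 0 < d &
    forall x, d * `|x| ^+ 2 <= \sum_i posp (dot x (a i)) ^+ 2.
Proof.
move=> pos_a; set h := fun x => \sum_i posp (dot x (a i)) ^+ 2.
have ch : continuous h.
  by apply: continuous_sum => i; exact: sqr_posp_dot_continuous.
have h_ge0 x : 0 <= h x by apply: sumr_ge0 => i _; exact: sqr_ge0.
pose S := [set x : 'rV[R]_n | `|x| = 1].
have unitS x : x != 0 -> S (`|x|^-1 *: x).
  by move=> x0; rewrite /S/= normrZ normfV normr_id mulVf ?normr_eq0.
suff [d d0 hd] : exists2 d, 0 < d & forall x, x != 0 -> d * `|x| ^+ 2 <= h x.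
  exists d => // x; have [->|/hd//] := eqVneq x 0.
  by rewrite normr0 expr0n mulr0; exact: h_ge0.
have [S0|S0] := pselect (S !=set0); last first.
  (* In dimension zero there is no unit vector to minimise over. *)
  by exists 1 => // x /unitS Sx; case: S0; eexists; exact: Sx.
have cS : compact S by exact: unit_sphere_compact.
have [c /set_mem/= c1 hmin] := EVT_min_rV S0 cS (continuous_subspaceT ch).
exists (h c).
  have c0 : c != 0 by rewrite -normr_eq0 c1 oner_eq0.
  have [i ci] := pos_a c c0.
  rewrite /h (bigD1 i)//= ltr_pwDl ?sumr_ge0//.
    by rewrite exprn_gt0// /posp lt_max ci.
  by move=> j _; exact: sqr_ge0.
move=> x x0; have := hmin (`|x|^-1 *: x); rewrite inE => /(_ (unitS _ x0)) hcx.
have -> : h x = h (`|x|^-1 *: x) * `|x| ^+ 2.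
  rewrite /h mulr_suml; apply: eq_bigr => i _.
  rewrite dotZl pospM ?invr_ge0// exprMn mulrAC exprVn mulVf ?mul1r//.
  by apply: expf_neq0; rewrite normr_eq0.
by rewrite ler_wpM2r// sqr_ge0.
Qed.

(** The witness [x] minimises [F x = \sum_i (<x, a_i>^+)^2 - 2 <x, v>]: the
    quadratic growth of the sum beats the linear term, so a minimiser exists,
    and the claim says that the gradient of [F] vanishes there. *)
Lemma finite_positive_combination n m (a : 'I_m -> 'rV[R]_n) :
  (forall u, u != 0 -> exists i, 0 < dot u (a i)) ->
  forall v, exists x, v = \sum_i posp (dot x (a i)) *: a i.
Proof.
move=> pos_a v; have [d d0 hd] := sum_posp_ge_norm pos_a.
pose F x := \sum_i posp (dot x (a i)) ^+ 2 - 2 * dot x v.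
have cF : continuous F.
  have ch : continuous (fun x => \sum_i posp (dot x (a i)) ^+ 2).
    by apply: continuous_sum => i; exact: sqr_posp_dot_continuous.
  move=> x; apply: (@cvgB _ _ _ (nbhs x)); first exact: ch.
  by apply: (@cvgM _ _ (nbhs x)); [exact: cvg_cst|exact: dot_continuous].
pose K := \sum_i `|v 0 i|.
have K0 : 0 <= K by apply: sumr_ge0.
(* Outside this ball the quadratic term dominates, so that F > 0 = F 0. *)
pose B := [set x : 'rV[R]_n | `|x| <= 2 * K / d].
have r0 : 0 <= 2 * K / d by rewrite divr_ge0 ?mulr_ge0// ltW.
have cB : compact B by exact: closed_norm_ball_compact.
have B0 : B 0 by rewrite /B/= normr0.
have F0 : F 0 = 0.
  have z y : dot 0 y = 0 :> R by rewrite -(scale0r 0) dotZl mul0r.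
  rewrite /F z mulr0 subr0 big1// => i _.
  by rewrite z /posp maxxx expr0n.
have [x _ xB] := EVT_min_rV (ex_intro _ _ B0) cB (continuous_subspaceT cF).
have xmin y : F x <= F y.
  have [yB|yB] := leP `|y| (2 * K / d); first by apply: xB; rewrite inE.
  apply: (@le_trans _ _ 0); first by rewrite -F0; apply: xB; rewrite inE.
  rewrite subr_ge0 (le_trans _ (hd y))//.
  rewrite (@le_trans _ _ (2 * (`|y| * K)))//.
    by rewrite ler_pM2l// dot_le_norm.
  move: yB; rewrite ltr_pdivrMr// => /ltW yB.
  by have := ler_wpM2l (normr_ge0 y) yB; lra.
exists x.
(* -2 w is the gradient of F at x; moving along w would decrease F. *)
pose w := v - \sum_i posp (dot x (a i)) *: a i.
have -> : v = w + \sum_i posp (dot x (a i)) *: a i by rewrite /w subrK.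
suff -> : w = 0 by rewrite add0r.
apply: dot_eq0.
pose C := \sum_i dot w (a i) ^+ 2.
have C0 : 0 <= C by apply: sumr_ge0 => i _; exact: sqr_ge0.
have Fw t : F (x + t *: w) <= F x - 2 * t * dot w w + t ^+ 2 * C.
  have -> : dot w w = dot w v - \sum_i posp (dot x (a i)) * dot w (a i).
    rewrite -dot_sumZr {2}/w [LHS]dotC dotDl (dotC v); congr (_ + _).
    by rewrite -scaleN1r dotZl mulN1r dotC.
  rewrite /F dotDl dotZl.
  have : \sum_i posp (dot (x + t *: w) (a i)) ^+ 2 <=
     \sum_i (posp (dot x (a i)) ^+ 2 +
       (2 * t * (posp (dot x (a i)) * dot w (a i)) +
        t ^+ 2 * dot w (a i) ^+ 2)).
    apply: ler_sum => i _; rewrite dotDl dotZl.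
    apply: le_trans (pospD_sqr_le _ _) _.
    by rewrite le_eqVlt; apply/orP; left; apply/eqP; ring.
  rewrite !big_split/= -!mulr_sumr -/C; lra.
(* The step |w|^2 / C minimises the bound; C + 1 avoids dividing by 0. *)
have C1 : 0 < C + 1 by lra.
have := le_trans (xmin _) (Fw (dot w w / (C + 1))).
have ww := dot_ge0 w.
set q := dot w w in ww *; set t := q / (C + 1).
have t0 : 0 <= t by rewrite divr_ge0// ltW.
have -> : q = t * (C + 1) by rewrite /t divfK// gt_eqF.
move=> H; have : t ^+ 2 * (C + 2) <= 0 by nra.
rewrite pmulr_lle0; last lra.
move=> t2; have /eqP : t ^+ 2 = 0 by apply: le_anti; rewrite t2 sqr_ge0.
by rewrite sqrf_eq0 => /eqP ->; rewrite mul0r.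
Qed.

(** The half-spaces [<u, y> > 0] with [y] in [A] cover the unit sphere; a finite
    subcover reduces the claim to a finite family. *)
Lemma pos_setT_of_no_polar n (A : set 'rV[R]_n) :
  (forall u, u != 0 -> exists2 y, A y & 0 < dot u y) -> pos A = setT.
Proof.
move=> HA; apply/seteqP; split => // v _.
have := @unit_sphere_compact R n; rewrite compact_cover.
move=> /(_ _ A (fun y => [set u | 0 < dot u y])) [y _| x /= x1 |D DA covD].
- apply: (@open_comp _ _ (fun u => dot u y) [set t | 0 < t]).
    by move=> x _; exact: dot_continuous.
  exact: open_gt.
- have /HA [y Ay xy] : x != 0 by rewrite -normr_eq0 x1 oner_eq0.
  by exists y.
pose l := finmap.enum_fset D; pose a (i : 'I_(size l)) := nth 0 l i.
have [u u0|x ->] := @finite_positive_combination n _ a _ v.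
  have /covD [y /= yD uy] : `|(`|u|^-1 *: u)| = 1.
    by rewrite normrZ normfV normr_id mulVf ?normr_eq0.
  have yl : (index y l < size l)%N by rewrite index_mem.
  exists (Ordinal yl); rewrite /a/= nth_index//.
  by move: uy; rewrite dotZl pmulr_rgt0// invr_gt0 normr_gt0.
exists (size l), a, (fun i => posp (dot x (a i))); split => // i.
  by apply: set_mem; apply: DA; exact: mem_nth.
exact: posp_ge0.
Qed.

End PositiveSpanning.

(** * Suprema of affine minorants *)

Section OuterLinearization.
Context {R : realType} {n : nat}.
Implicit Types (psi : 'rV[R]_n -> \bar R) (x y : 'rV[R]_n) (Y : set 'rV[R]_n).
Local Open Scope ereal_scope.

(** A constant [c] makes [<x, y> + c] a minorant of [psi] exactly when
    [<x, y> - psi x <= - c] for all [x]; the least value of [- c] is then the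
    supremum of the left-hand sides. *)
Lemma interceptE psi y : (forall x, -oo < psi x) -> Defs.proper psi ->
  intercept psi y = - legendre psi y.
Proof.
move=> psiNy psi_proper; have [x0 x0fin] := psi_proper.
have [[_ minor] maxi] := intercept_max y psi_proper.
have swap x (c : \bar R) :
    (dot x y)%:E + c <= psi x <-> (dot x y)%:E - psi x <= - c.
  have := psiNy x; case: (psi x) => [r||]//= _; case: c => [c||]//=;
    rewrite ?leey ?leNye// -?EFinD ?lee_fin//.
  by split => ?; lra.
have dual x : dot x y = dot y x by exact: dotC.
apply/le_anti/andP; split.
  rewrite leeNr; apply: ge_ereal_sup => _ [x _ <-].
  by rewrite -dual; apply/swap.
apply: maxi; split.
  rewrite lteNl /=; apply: lt_le_trans (ereal_sup_ubound _); last by exists x0.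
  by case: (psi x0) x0fin (psiNy x0) => [r||]//= _ _; rewrite -EFinB ltNyr.
move=> x; apply/swap; rewrite oppeK; apply: ereal_sup_ubound.
by exists x => //; rewrite -dual.
Qed.

Lemma outer_lin_sup_ubound psi Y y x : Y y ->
  outer_lin psi y x <= outer_lin_sup psi Y x.
Proof. by move=> Yy; apply: ereal_sup_ubound; exists y. Qed.

Lemma outer_lin_sup_le psi Y x : Defs.proper psi ->
  outer_lin_sup psi Y x <= psi x.
Proof.
move=> psi_proper; apply: ge_ereal_sup => _ [y _ <-].
by have [[_ ->]] := intercept_max y psi_proper.
Qed.

Lemma econvex_outer_lin_sup psi Y : Defs.proper psi ->
  econvex (outer_lin_sup psi Y).
Proof.
move=> psi_proper x z t /andP[t0 t1]; apply: ge_ereal_sup => _ [y Yy <-].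
have [[cy _] _] := intercept_max y psi_proper.
have hx := outer_lin_sup_ubound psi x Yy.
have hz := outer_lin_sup_ubound psi z Yy.
move: hx hz; rewrite /outer_lin; move: cy.
case: (intercept psi y) => [c _ hx hz||]//; last first.
  by move=> _ _ _; rewrite addeNy leNye.
have t10 : (0 <= 1 - t)%R by rewrite subr_ge0.
apply: le_trans (leeD (lee_wpmul2l _ hx) (lee_wpmul2l _ hz));
  rewrite ?lee_fin//.
by rewrite dotDl !dotZl; lra.
Qed.

Lemma lower_semicontinuous_outer_lin_sup psi Y : Defs.proper psi ->
  lower_semicontinuous (outer_lin_sup psi Y).
Proof.
move=> psi_proper x a /ereal_sup_gt[_ [y Yy <-]].
have [[cy _] _] := intercept_max y psi_proper.
rewrite /outer_lin; case E : (intercept psi y) cy => [c||]// _.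
rewrite -EFinD lte_fin -ltrBlDr => axy.
exists [set z | a - c < dot z y]%R.
  apply: open_nbhs_nbhs; split => //.
  apply: (@open_comp _ _ (fun u => dot u y) [set t | a - c < t]%R).
    by move=> z _; exact: dot_continuous.
  exact: open_gt.
move=> z /= azy; apply: lt_le_trans (outer_lin_sup_ubound psi z Yy).
by rewrite /outer_lin E -EFinD lte_fin -ltrBlDr.
Qed.

(** Where the supremum is at most [M], each slope [y] gives the bound
    [<x, y> <= M - intercept psi y], and such bounds pass to nonnegative
    combinations of slopes. *)
Lemma pos_bounded_on_sublevel psi Y w (M : R) :
  (forall y, Y y -> intercept psi y \is a fin_num) -> pos Y w ->
  exists B : R, forall x, outer_lin_sup psi Y x <= M%:E -> (dot x w <= B)%R.
Proof.
move=> fin_int [m [a [c [Ya c0 ->]]]].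
exists (\sum_(i < m) c i * (M - fine (intercept psi (a i))))%R => x qM.
rewrite dot_sumZr; apply: ler_sum => i _; apply: ler_wpM2l => //.
have := le_trans (outer_lin_sup_ubound psi x (Ya i)) qM.
rewrite /outer_lin -{1}(fineK (fin_int _ (Ya i))) -EFinD lee_fin; lra.
Qed.

(** Bounding [<x, w>] on a sublevel set for [w] running over the unit vectors
    and their opposites bounds all coordinates of [x]. *)
Lemma coercive_outer_lin_sup psi Y :
  (forall y, Y y -> intercept psi y \is a fin_num) -> pos Y = setT ->
  coercive (outer_lin_sup psi Y).
Proof.
move=> fin_int posY M.
have bnd w : exists B : R, forall x,
    outer_lin_sup psi Y x <= M%:E -> (dot x w <= B)%R.
  by apply: pos_bounded_on_sublevel => //; rewrite posY.
have [B HB] := choice bnd.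
pose e i : 'rV[R]_n := delta_mx 0%R i.
exists (\sum_i Num.max (B (e i)) (B (- e i)))%R => x xr.
rewrite ltNge; apply/negP => qM; move: xr; apply/negP; rewrite -leNgt.
apply: le_trans (enorm_le_sum _) _; apply: ler_sum => i _.
have [h1 h2] := (HB (e i) _ qM, HB (- e i)%R _ qM).
rewrite ler_norml le_max lerNl le_max -[x _ i]dot_delta h1/=.
have -> : (- dot x (delta_mx 0 i) = dot x (- e i))%R.
  by rewrite -[(- e i)%R]scaleN1r dotC [in RHS]dotC dotZl mulN1r.
by rewrite h2 !orbT.
Qed.

(** Each minorant with slope [y] is nonincreasing in the direction [u] or
    constantly -oo, hence so is their supremum. *)
Lemma outer_lin_sup_ray psi Y x u (t : R) : (0 <= t)%R ->
  (forall y, Y y -> -oo < intercept psi y -> (dot u y <= 0)%R) ->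
  outer_lin_sup psi Y (x + t *: u)%R <= outer_lin_sup psi Y x.
Proof.
move=> t0 uY; apply: ge_ereal_sup => _ [y Yy <-].
apply: le_trans (outer_lin_sup_ubound psi x Yy); rewrite /outer_lin.
have [|cy] := leP (intercept psi y) -oo.
  by rewrite leeNy_eq => /eqP ->; rewrite !addeNy.
rewrite leeD2r// lee_fin dotDl dotZl gerDl mulr_ge0_le0//.
exact: uY.
Qed.

Lemma coercive_unbounded_ray (f : 'rV[R]_n -> \bar R) x u : coercive f ->
  u != 0%R -> f x < +oo -> exists2 t : R, (0 <= t)%R & f x < f (x + t *: u)%R.
Proof.
move=> cf u0 fx.
have [i ui] : exists i, u 0%R i != 0%R.
  apply/existsP; rewrite -negb_forall; apply: contraNN u0 => /forallP u0.
  by apply/eqP/rowP => i; rewrite mxE; apply/eqP.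
have [M fM] : exists M : R, f x <= M%:E.
  by case: (f x) fx => [r||]// _; [exists r|exists 0%R; rewrite leNye].
have [r Hr] := cf M.
(* t makes coordinate i of x + t *: u larger than r in absolute value. *)
pose t := ((`|r| + `|x 0 i| + 1) / `|u 0 i|)%R.
have t0 : (0 <= t)%R by rewrite divr_ge0// !addr_ge0.
exists t => //; apply: le_lt_trans fM _; apply: Hr.
apply: lt_le_trans (coord_le_enorm _ i); rewrite !mxE.
have : (`|t * u 0 i| = `|r| + `|x 0 i| + 1)%R.
  by rewrite normrM (ger0_norm t0) /t divfK// normr_eq0.
have := lerB_dist (t * u 0 i)%R (- x 0 i)%R.
rewrite normrN opprK [(_ + x _ _)%R]addrC => h1 h2.
by have := ler_norm r; lra.
Qed.

End OuterLinearization.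

(** * Coercivity and positive spanning *)

Theorem proposition5p7 (R : realType) (n : nat) (n_ge1 : (1 <= n)%N)
    (psi : 'rV[R]_n -> \bar R) (Y : set 'rV[R]_n) :
  Conv_c psi -> Y !=set0 ->
  (Conv_c (outer_lin_sup psi Y) <->
   exists Yo : set 'rV[R]_n,
     [/\ Yo `<=` Y, Yo `<=` dom (legendre psi) & pos Yo = setT]).
Proof.
move=> [psiNy [_ psi_proper _ _]] Y0.
have domE y : dom (legendre psi) y <-> (-oo < intercept psi y)%E.
  by rewrite interceptE// lteNr.
split=> [[qNy [_ [x0 qx0] _ qcoer]]|[Yo [YoY Yodom posYo]]].
  exists (Y `&` dom (legendre psi)); split=> [y []//|y []//|].
  apply: pos_setT_of_no_polar => u u0; apply: contrapT => noy.
  have [t t0] := coercive_unbounded_ray qcoer u0 qx0.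
  apply/negP; rewrite -leNgt; apply: outer_lin_sup_ray => // y Yy /domE dy.
  by rewrite leNgt; apply/negP => uy; apply: noy; exists y.
have fin_int y : Yo y -> intercept psi y \is a fin_num.
  move=> /Yodom/domE; rewrite ltNye fin_numE => ->/=.
  by have [[+ _] _] := intercept_max y psi_proper; rewrite lt_neqAle => /andP[].
have mono x : (outer_lin_sup psi Yo x <= outer_lin_sup psi Y x)%E.
  by apply: ge_ereal_sup => _ [y /YoY Yy <-]; exact: outer_lin_sup_ubound.
(* The positive hull of the empty set is {0}, a proper subset as n >= 1. *)
have [y Yoy] : Yo !=set0.
  apply: contrapT => Yo0; have : pos Yo (const_mx 1) by rewrite posYo.
  move=> [[|m] [a [c [Ya _]]]]; last by case: Yo0; exists (a ord0).
  rewrite big_ord0 => /rowP/(_ (Ordinal n_ge1)); rewrite !mxE.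
  by apply/eqP; rewrite oner_eq0.
have qNy x : (-oo < outer_lin_sup psi Y x)%E.
  apply: lt_le_trans (mono x).
  apply: lt_le_trans (outer_lin_sup_ubound psi x Yoy).
  by rewrite /outer_lin -(fineK (fin_int _ Yoy)) ltNyr.
split => //; split.
- exact: econvex_outer_lin_sup.
- have [x xfin] := psi_proper; exists x.
  by apply: le_lt_trans xfin; exact: outer_lin_sup_le.
- exact: lower_semicontinuous_outer_lin_sup.
- move=> M; have [r Hr] := coercive_outer_lin_sup fin_int posYo M.
  by exists r => x /Hr/lt_le_trans; apply.
Qed.
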